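(* Let $R$ be a commutative ring with $1_R\neq 0_R$, $k\geq 1$, and let $M$ be an $R$-module. If $R$ is artinian, then there are isomorphisms of $R[\mathbf{x}]$-modules $$\mathcal{L}_M^{<k>}\simeq \mathcal{D}_M^{<k>}\oplus \widetilde{\mathcal{L}}_M^{<k>}=\mathcal{D}_M^{<k>}\oplus \widetilde{\mathcal{B}}_M^{<k>}\simeq \mathcal{D}_M^{<k>}\oplus \mathcal{B}_M^{<k>}=\mathcal{D}_M^{<k>}\oplus \mathcal{R}_M^{<k>}.$$
   Context: Write $R[\mathbf{x}]=R[x_1,\dots,x_k]$ and $\mathbf{x}^{\mathbf{n}}=x_1^{n_1}\cdots x_k^{n_k}$. A $k$-sequence over $M$ is a function $u:\mathbb{N}_0^k\to M$. A $k$-bisequence over $M$ is a function $\widetilde u:\mathbb{Z}^k\to M$. For $f=\sum_{\mathbf{i}} a_{\mathbf{i}}\mathbf{x}^{\mathbf{i}}\in R[\mathbf{x}]$ put $(f\rightharpoonup u)(\mathbf{n})=\sum_{\mathbf{i}} a_{\mathbf{i}}u(\mathbf{n}+\mathbf{i})$, and likewise for bisequences (also for Laurent polynomials). These make the sets of $k$-sequences and of $k$-bisequences into $R[\mathbf{x}]$-modules. $\mathrm{An}_{R[\mathbf{x}]}(u)=\{f\in R[\mathbf{x}]: f\rightharpoonup u=0\}$, and likewise for bisequences. A monic polynomial $q(x)\in R[x]$ is reversible if $q(0)$ is a unit of $R$. An ideal is monic (resp. reversible) if it contains monic (resp. reversible) polynomials $f_1(x_1),\dots,f_k(x_k)$,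 where $f_j$ is a polynomial in the single variable $x_j$. $\mathcal{L}_M^{<k>}$ (resp. $\mathcal{B}_M^{<k>}$) is the $R[\mathbf{x}]$-module of $k$-sequences $u$ over $M$ with $\mathrm{An}_{R[\mathbf{x}]}(u)$ monic (resp. reversible); these are the linearly recursive (resp. linearly birecursive) $k$-sequences. $\widetilde{\mathcal{L}}_M^{<k>}$ (resp. $\widetilde{\mathcal{B}}_M^{<k>}$) is the module of $k$-bisequences $\widetilde u$ over $M$ with $\mathrm{An}_{R[\mathbf{x}]}(\widetilde u)$ monic (resp. reversible). A reverse of a $k$-sequence $u$ is a $k$-bisequence $\widetilde u$ with $\widetilde u|_{\mathbb{N}_0^k}=u$ and $\mathrm{An}_{R[\mathbf{x}]}(\widetilde u)=\mathrm{An}_{R[\mathbf{x}]}(u)$. $\mathcal{R}_M^{<k>}\subseteq \mathcal{L}_M^{<k>}$ is the set of reversible $k$-sequences, i.e. those $u\in\mathcal{L}_M^{<k>}$ having a reverse in $\widetilde{\mathcal{L}}_M^{<k>}$. $\mathcal{D}_M^{<k>}=\{u\in\mathcal{L}_M^{<k>}: \mathbf{x}^{\mathbf{d}}\rightharpoonup u=0 \text{ for some } \mathbf{d}\in\mathbb{N}_0^k\}$ is the $R[\mathbf{x}]$-module of degenerating $k$-sequences. *)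

(* Defs.v *)
From HB Require Import structures.
From mathcomp Require Import all_boot all_order all_algebra.
From mathcomp Require Import boolp classical_sets functions.
From mathcomp Require Import mpoly.

Set Implicit Arguments.
Unset Strict Implicit.
Unset Printing Implicit Defensive.

Import Order.TTheory GRing.Theory Num.Theory.
Local Open Scope classical_set_scope.
Local Open Scope ring_scope.

(* Descending chain condition on ideals; the ideals of R are the submodules of
   the regular module R^o. *)
Definition artinian (R : comNzRingType) : Prop :=
  forall I : nat -> set R^o,
    (forall n, submod_closed (mem (I n))) ->
    (forall n, I n.+1 `<=` I n) ->
    exists N : nat, forall n : nat, (N <= n)%N -> I n = I N.

(* Isomorphism between two submodules, given as subsets A and B of ambient
   modules U and V; only the values of f on A matter. *)
Definition submod_iso (S : nzRingType) (U V : lmodType S)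
    (A : set U) (B : set V) : Prop :=
  exists f : U -> V,
    [/\ set_bij A B f,
        {in A &, {morph f : u v / u + v}} &
        forall a : S, {in A, {morph f : u / a *: u}}].

Section ShiftAction.
Variables (R : comNzRingType) (M : lmodType R) (k : nat) (I : Type).
Variable shift : I -> 'X_{1..k} -> I.
Hypothesis shift0 : forall n, shift n 0%MM = n.
Hypothesis shiftD : forall n i j, shift (shift n i) j = shift n (i + j)%MM.

Implicit Types (f g : {mpoly R[k]}) (u v : I -> M).

Definition shift_act f u : I -> M :=
  fun n => \sum_(i <- msupp f) f@_i *: u (shift n i).

Lemma shift_actw f u n (s : seq 'X_{1..k}) : uniq s -> {subset msupp f <= s} ->
  shift_act f u n = \sum_(i <- s) f@_i *: u (shift n i).
Proof.
move=> s_uniq sub; rewrite (bigID (mem (msupp f))) /= [X in _ + X]big1 ?addr0.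
  rewrite -big_filter; apply: perm_big; apply: uniq_perm.
  - exact: msupp_uniq.
  - exact: filter_uniq.
  by move=> i; rewrite mem_filter /=; case: (boolP (i \in msupp f)) => // /sub.
by move=> i; rewrite mcoeff_msupp negbK => /eqP ->; rewrite scale0r.
Qed.

Lemma shift_actDl u : {morph shift_act^~ u : f g / f + g}.
Proof.
move=> f g /=; apply/funext => n.
pose s := undup (msupp f ++ msupp g ++ msupp (f + g)).
have su : uniq s by exact: undup_uniq.
transitivity (shift_act f u n + shift_act g u n); last by [].
rewrite !(@shift_actw _ _ _ s) //;
  last 3 first.
- by move=> i Hi; rewrite mem_undup !mem_cat Hi ?orbT.
- by move=> i Hi; rewrite mem_undup !mem_cat Hi ?orbT.
- by move=> i Hi; rewrite mem_undup !mem_cat Hi ?orbT.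
by rewrite -big_split /=; apply: eq_bigr => i _; rewrite mcoeffD scalerDl.
Qed.

Lemma shift_actDr : right_distributive shift_act +%R.
Proof.
move=> f u v; apply/funext => n.
transitivity (shift_act f u n + shift_act f v n); last by [].
rewrite -big_split /=.
by apply: eq_bigr => i _; rewrite -scalerDr.
Qed.

Lemma shift_act_mono c m u n :
  shift_act (c *: 'X_[m]) u n = c *: u (shift n m).
Proof.
rewrite (@shift_actw _ _ _ [:: m]) //.
  by rewrite big_seq1 mcoeffZ mcoeffX eqxx mulr1.
by move=> i /msuppZ_le; rewrite msuppX.
Qed.

Lemma shift_act1 : left_id 1 shift_act.
Proof.
move=> u; apply/funext => n.
by rewrite -[1]scale1r -mpolyX0 shift_act_mono scale1r shift0.
Qed.

Lemma shift_act0 u : shift_act 0 u = 0.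
Proof. by apply/funext => n; rewrite /shift_act msupp0 big_nil. Qed.

Lemma shift_actA f g u : shift_act f (shift_act g u) = shift_act (f * g) u.
Proof.
elim/mpolyind: f => [|c m f _ _ IHf]; first by rewrite mul0r !shift_act0.
rewrite mulrDl !shift_actDl IHf; congr (_ + _).
elim/mpolyind: g {IHf} => [|d p g _ _ IHg].
  rewrite mulr0 !shift_act0; apply/funext => n.
  by rewrite shift_act_mono scaler0.
rewrite mulrDr !shift_actDl shift_actDr IHg; congr (_ + _).
apply/funext => n; rewrite -scalerAl -scalerAr scalerA -mpolyXD.
by rewrite !shift_act_mono scalerA shiftD.
Qed.

End ShiftAction.

Definition kseq (R : comNzRingType) (M : lmodType R) (k : nat) : Type :=
  'X_{1..k} -> M.

Definition kbiseq (R : comNzRingType) (M : lmodType R) (k : nat) : Type :=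
  {ffun 'I_k -> int} -> M.

Definition mnm_int (k : nat) (i : 'X_{1..k}) : {ffun 'I_k -> int} :=
  [ffun j => (i j)%:Z].

Section Modules.
Variables (R : comNzRingType) (M : lmodType R) (k : nat).

HB.instance Definition _ := GRing.Zmodule.copy (kseq M k) ('X_{1..k} -> M).
HB.instance Definition _ :=
  GRing.Zmodule.copy (kbiseq M k) ({ffun 'I_k -> int} -> M).

Definition kseq_act (f : {mpoly R[k]}) (u : kseq M k) : kseq M k :=
  shift_act (fun n i => (n + i)%MM) f u.

Definition kbiseq_act (f : {mpoly R[k]}) (w : kbiseq M k) : kbiseq M k :=
  shift_act (fun n i => n + mnm_int i) f w.

Lemma kseq_actA f g u : kseq_act f (kseq_act g u) = kseq_act (f * g) u.
Proof. by apply: shift_actA => n i j; rewrite addmA. Qed.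

Lemma kseq_act1 : left_id 1 kseq_act.
Proof. by move=> u; apply: shift_act1 => n; rewrite addm0. Qed.

Lemma kseq_actDr : right_distributive kseq_act +%R.
Proof. exact: shift_actDr. Qed.

Lemma kseq_actDl u : {morph kseq_act^~ u : f g / f + g}.
Proof. exact: shift_actDl. Qed.

Lemma kbiseq_actA f g w : kbiseq_act f (kbiseq_act g w) = kbiseq_act (f * g) w.
Proof.
apply: shift_actA => n i j; apply/ffunP => l.
by rewrite !ffunE mnmDE PoszD addrA.
Qed.

Lemma kbiseq_act1 : left_id 1 kbiseq_act.
Proof.
move=> w; apply: shift_act1 => n; apply/ffunP => l.
by rewrite !ffunE mnm0E addr0.
Qed.

Lemma kbiseq_actDr : right_distributive kbiseq_act +%R.
Proof. exact: shift_actDr. Qed.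

Lemma kbiseq_actDl w : {morph kbiseq_act^~ w : f g / f + g}.
Proof. exact: shift_actDl. Qed.

HB.instance Definition _ := GRing.Zmodule_isLmodule.Build {mpoly R[k]}
  (kseq M k) kseq_actA kseq_act1 kseq_actDr kseq_actDl.
HB.instance Definition _ := GRing.Zmodule_isLmodule.Build {mpoly R[k]}
  (kbiseq M k) kbiseq_actA kbiseq_act1 kbiseq_actDr kbiseq_actDl.

Lemma kseq_scaleE (f : {mpoly R[k]}) (u : kseq M k) (n : 'X_{1..k}) :
  (f *: u) n = \sum_(i <- msupp f) f@_i *: u (n + i)%MM.
Proof. by []. Qed.

Lemma kbiseq_scaleE (f : {mpoly R[k]}) (w : kbiseq M k) n :
  (f *: w) n = \sum_(i <- msupp f) f@_i *: w (n + mnm_int i).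
Proof. by []. Qed.

End Modules.

Definition annihilator (S : nzRingType) (U : lmodType S) (u : U) : set S :=
  [set f | f *: u = 0].

(* R need not come with a decidable unit predicate, so "q(0) is a unit" is
   spelled out. *)
Definition reversible_poly (R : comNzRingType) (q : {poly R}) : Prop :=
  q \is monic /\ exists c : R, c * q.[0] = 1.

(* The image q(x_j) of a univariate polynomial q. *)
Definition poly_at (R : comNzRingType) (k : nat) (j : 'I_k) (q : {poly R}) :
    {mpoly R[k]} :=
  (map_poly (@mpolyC k R) q).['X_j].

Definition monic_ideal (R : comNzRingType) (k : nat)
    (J : set {mpoly R[k]}) : Prop :=
  forall j : 'I_k, exists2 q : {poly R}, q \is monic & J (poly_at j q).

Definition reversible_ideal (R : comNzRingType) (k : nat)
    (J : set {mpoly R[k]}) : Prop :=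
  forall j : 'I_k, exists2 q : {poly R}, reversible_poly q & J (poly_at j q).

Section Recursive.
Variables (R : comNzRingType) (M : lmodType R) (k : nat).

Definition lin_rec : set (kseq M k) :=
  [set u | monic_ideal (annihilator u)].

Definition lin_birec : set (kseq M k) :=
  [set u | reversible_ideal (annihilator u)].

Definition bi_lin_rec : set (kbiseq M k) :=
  [set w | monic_ideal (annihilator w)].

Definition bi_lin_birec : set (kbiseq M k) :=
  [set w | reversible_ideal (annihilator w)].

Definition is_reverse (u : kseq M k) (w : kbiseq M k) : Prop :=
  (forall n : 'X_{1..k}, w (mnm_int n) = u n) /\ annihilator w = annihilator u.

Definition reversible_seq : set (kseq M k) :=
  [set u | lin_rec u /\ exists2 w, bi_lin_rec w & is_reverse u w].

Definition degenerating : set (kseq M k) :=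
  [set u | lin_rec u /\
           exists d : 'X_{1..k}, ('X_[d] : {mpoly R[k]}) *: u = 0].

End Recursive.

Arguments lin_rec {R} M k.
Arguments lin_birec {R} M k.
Arguments bi_lin_rec {R} M k.
Arguments bi_lin_birec {R} M k.
Arguments reversible_seq {R} M k.
Arguments degenerating {R} M k.

Section Submodules.
Variables (R : comNzRingType) (k : nat).

Lemma poly_at_prod (j : 'I_k) (p q : {poly R}) :
  poly_at j (p * q) = poly_at j p * poly_at j q.
Proof. by rewrite /poly_at rmorphM hornerM. Qed.

Lemma poly_at1 (j : 'I_k) : poly_at j (1 : {poly R}) = 1.
Proof. by rewrite /poly_at rmorph1 hornerC. Qed.

Lemma reversible_poly1 : reversible_poly (1 : {poly R}).
Proof. by split; [exact: monic1 | exists 1; rewrite hornerC mulr1]. Qed.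

Lemma reversible_polyM (p q : {poly R}) :
  reversible_poly p -> reversible_poly q -> reversible_poly (p * q).
Proof.
move=> [pm [c hc]] [qm [d hd]]; split; first exact: rpredM.
by exists (c * d); rewrite hornerM mulrACA hc hd mulr1.
Qed.

Lemma ann_submod (U : lmodType {mpoly R[k]}) (P : {poly R} -> Prop) :
  P 1 -> (forall p q, P p -> P q -> P (p * q)) ->
  submod_closed (mem [set u : U | forall j : 'I_k,
    exists2 q, P q & annihilator u (poly_at j q)]).
Proof.
move=> P1 PM; split=> [|a u v /set_mem /= hu /set_mem /= hv]; apply/mem_set => j.
  by exists 1 => //; rewrite /annihilator /= scaler0.
have [p Pp pu] := hu j; have [q Pq qv] := hv j.
exists (p * q); first exact: PM.
rewrite /annihilator /= poly_at_prod in pu qv *.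
rewrite scalerDr -[in X in _ + X]scalerA qv scaler0.
by rewrite addr0 scalerA -mulrA mulrC -scalerA pu scaler0.
Qed.

Variable M : lmodType R.

Lemma lin_rec_submod : submod_closed (mem (lin_rec M k)).
Proof. by apply: ann_submod => [|p q]; [exact: monic1 | exact: rpredM]. Qed.

Lemma lin_birec_submod : submod_closed (mem (lin_birec M k)).
Proof.
by apply: ann_submod => [|p q]; [exact: reversible_poly1 | exact: reversible_polyM].
Qed.

Lemma bi_lin_rec_submod : submod_closed (mem (bi_lin_rec M k)).
Proof. by apply: ann_submod => [|p q]; [exact: monic1 | exact: rpredM]. Qed.

Lemma bi_lin_birec_submod : submod_closed (mem (bi_lin_birec M k)).
Proof.
by apply: ann_submod => [|p q]; [exact: reversible_poly1 | exact: reversible_polyM].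
Qed.

Lemma degenerating_submod : submod_closed (mem (degenerating M k)).
Proof.
have [L0 LD] := lin_rec_submod.
split=> [|a u v /set_mem [Lu [d du]] /set_mem [Lv [e ev]]]; apply/mem_set; split.
- exact: set_mem L0.
- by exists 0%MM; rewrite scaler0.
- by apply: set_mem; apply: LD; exact: mem_set.
exists (d + e)%MM; rewrite mpolyXD scalerDr -[in X in _ + X]scalerA ev scaler0.
by rewrite addr0 scalerA -mulrA mulrC -scalerA du scaler0.
Qed.

End Submodules.

(* Main.v *)
Require Import Defs.
From HB Require Import structures.
From mathcomp Require Import all_boot all_order all_algebra.
From mathcomp Require Import boolp classical_sets functions.
From mathcomp Require Import mpoly ring.

(** Over an artinian ring every element [a] satisfies [a^n (1 - a b) = 0] for
    some [n] and [b].  This property alone drives the proof: by induction on the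
    degree it passes to monic polynomials, each of which divides some [x^n r]
    with [r] reversible ([monic_dvd_Xn_reversible]).

    Let [X] be the product of the variables.  If the annihilator of [u] is
    monic, then the annihilator of [X^n u] is therefore reversible for some [n]
    ([monic_reversible_after_shift]).  If the annihilator of [u] is reversible,
    then the variables act invertibly on the submodule generated by [u]: there
    is a polynomial [G] with [X G u = u] ([reversible_invertible]).

    On bisequences monomials act bijectively, so that [X^n w] and [w] have the
    same annihilator, and monic annihilators are reversible.  On sequences [G]
    computes the values at negative indices, namely
    [w(n) = (G^N u)(n + (N, ..., N))] for large [N].  This [w] is a reverse of
    [u] ([reversible_has_reverse]).  Hence restriction to nonnegative indices is
    an isomorphism from birecursive bisequences to birecursive sequences, and
    birecursive sequences are exactly the reversible ones.

    The first isomorphism is inverse to [(d, w) |-> d + w|_N].  It is onto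
    because for a recursive [u] one extends [X^n u] to a bisequence, shifts it
    back by [X^-n], and the restriction of the result differs from [u] by a
    sequence which [X^n] kills.  It is injective because a monomial killing
    [d = - w|_N] kills [w], hence [w = 0]. *)

Set Implicit Arguments.
Unset Strict Implicit.
Unset Printing Implicit Defensive.

Import Order.TTheory GRing.Theory Num.Theory.
Local Open Scope classical_set_scope.
Local Open Scope ring_scope.

(** * Monic polynomials over an artinian ring *)

(** The chain of ideals [(a^n)] is stationary. *)
Lemma artinian_pi_regular (R : comNzRingType) (a : R) :
  artinian R -> exists n b, a ^+ n * (1 - a * b) = 0.
Proof.
move=> Rart.
pose I n : set R^o := [set x | exists y : R, x = a ^+ n * y].
have [||N stable] := Rart I.
- move=> n; split=> [|c x y /set_mem [x' ->] /set_mem [y' ->]]; apply/mem_set.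
    by exists 0; rewrite mulr0.
  exists (c * x' + y'); rewrite mulrDr; congr (_ + _).
  by rewrite mulrCA.
- by move=> n x [y ->]; exists (a * y); rewrite exprSr mulrA.
have : I N (a ^+ N) by exists 1; rewrite mulr1.
rewrite -(stable N.+1) // => -[b eqb].
by exists N, b; rewrite mulrBr mulr1 mulrA -exprSr -eqb subrr.
Qed.

(** Write [q = x p + a].  Modulo [q] one has [a = - x p], so the relation
    [a^n (1 - a b) = 0] becomes [x^n p^n (1 + x p b) = 0], and the induction
    hypothesis replaces [p^n] by a power of [x] times a polynomial with constant
    term 1. *)
Lemma monic_dvd_Xn_const1 (R : comNzRingType) (q : {poly R}) :
  artinian R -> q \is monic ->
  exists n, exists h s : {poly R}, h.[0] = 1 /\ s * q = 'X^n * h.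
Proof.
move=> Rart; have [m] := ubnP (size q).
elim: m q => // m IHm q; elim/poly_ind: q => [|p a _].
  by rewrite monicE lead_coef0 eq_sym oner_eq0.
move=> szq qmon.
have [p0|pn0] := eqVneq p 0.
  move: qmon; rewrite p0 mul0r add0r monicE lead_coefC => /eqP ->.
  by exists 0%N, 1, 1; rewrite hornerC expr0.
have szpX : size (p * 'X)%R = (size p).+1 by rewrite size_mulX.
have szlt : (size a%:P < size (p * 'X)%R)%N.
  by rewrite szpX ltnS (leq_trans (size_polyC_leq1 a)) // size_poly_gt0.
have pmon : p \is monic.
  by move: qmon; rewrite !monicE lead_coefDl // lead_coefMX.
have [|n1 [h1 [s1 [h10 e1]]]] := IHm p _ pmon.
  by move: szq; rewrite size_polyDl // szpX.
have [n [b eab]] := artinian_pi_regular a Rart.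
set q := p * 'X + a%:P.
have [t et] : exists t, t * q = (- (p * 'X)) ^+ n - (a%:P) ^+ n.
  exists (- \sum_(i < n) (- (p * 'X)) ^+ (n.-1 - i) * a%:P ^+ i).
  by rewrite subrXX mulNr -mulrN mulrC opprD.
exists (n + n1 * n)%N, (h1 ^+ n * (1 + p * 'X * b%:P)).
(* Start from [a^n (1 - a b) = 0].  Replacing the second factor by [1 + x p b]
   adds [a^n b q]; then replacing [a^n] by [(- x p)^n] adds
   [t q (1 + x p b)]. *)
exists ((-1) ^+ n * s1 ^+ n * (t * (1 + p * 'X * b%:P) + a%:P ^+ n * b%:P)).
split.
  rewrite hornerM horner_exp h10 expr1n mul1r hornerD hornerM hornerMX.
  by rewrite mulr0 mul0r hornerC addr0.
have eabP : a%:P ^+ n * (1 - a%:P * b%:P) = 0.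
  by rewrite -polyC_exp -polyCM -[1]/(1%:P) -polyCB -polyCM eab.
have key : (t * (1 + p * 'X * b%:P) + a%:P ^+ n * b%:P) * q
   = (- (p * 'X)) ^+ n * (1 + p * 'X * b%:P).
  rewrite mulrDl mulrAC et -[RHS]subr0 -eabP /q.
  move: (a%:P ^+ n) (_ ^+ n) (_ * 'X) => an pn P; ring.
have -> : (-1) ^+ n * s1 ^+ n * (t * (1 + p * 'X * b%:P) + a%:P ^+ n * b%:P) * q
   = ((-1) * (-1)) ^+ n * (s1 * p) ^+ n * 'X^n * (1 + p * 'X * b%:P).
  rewrite -mulrA key [(- (p * 'X)) ^+ n]exprNn !exprMn.
  move: ((-1) ^+ n) (s1 ^+ n) (p ^+ n) => e sn pn; ring.
by rewrite mulrNN mulr1 expr1n mul1r e1 exprMn exprD exprM; ring.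
Qed.

(** Adding a multiple [x^N q] with large [N] to a polynomial with constant term
    1 makes it monic and does not change the constant term. *)
Lemma monic_dvd_Xn_reversible (R : comNzRingType) (q : {poly R}) :
  artinian R -> q \is monic ->
  exists n, exists r s : {poly R}, reversible_poly r /\ s * q = 'X^n * r.
Proof.
move=> Rart qmon; have [n [h [s [h0 e]]]] := monic_dvd_Xn_const1 Rart qmon.
exists n, ('X^((size h).+1) * q + h), (s + 'X^n * 'X^((size h).+1)); split.
  split; last first.
    exists 1; rewrite hornerD hornerM hornerXn expr0n h0 mul0r add0r.
    by rewrite mulr1.
  rewrite monicE lead_coefDl ?lead_coef_Mmonic ?lead_coefXn //.
  rewrite mulrC size_mulXn ?monic_neq0 //.
  by rewrite addSn ltnS leq_addr.
by rewrite mulrDl e mulrDr addrC mulrA.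
Qed.

(** * Annihilators under multiplication by monomials *)

Definition mones (k : nat) : 'X_{1..k} := [multinom 1%N | i < k].

Section PolyAt.
Variables (R : comNzRingType) (k : nat).
Implicit Types (j : 'I_k) (p q : {poly R}).

Lemma poly_atD j p q : poly_at j (p + q) = poly_at j p + poly_at j q.
Proof. by rewrite /poly_at rmorphD hornerD. Qed.

Lemma poly_atC j (c : R) : poly_at j c%:P = c%:MP.
Proof. by rewrite /poly_at map_polyC hornerC. Qed.

Lemma poly_atXn j n : poly_at j ('X^n : {poly R}) = 'X_j ^+ n.
Proof. by rewrite /poly_at rmorphXn /= map_polyX hornerXn. Qed.

Lemma mpolyX_mones : 'X_[mones k] = \prod_(j < k) 'X_j :> {mpoly R[k]}.
Proof.
by rewrite mpolyXE_id; apply: eq_bigr => j _; rewrite mnmE expr1.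
Qed.

Variables (U : lmodType {mpoly R[k]}).
Implicit Types u : U.

Lemma annihilatorZ (f g : {mpoly R[k]}) u :
  annihilator u f -> annihilator (g *: u) f.
Proof. by rewrite /annihilator /= => fu; rewrite scalerA mulrC -scalerA fu scaler0. Qed.

(** If [q_j(x_j)] kills [u] and [q_j] divides [x^(n_j) r_j], then [r_j(x_j)]
    kills [x_j^(n_j) u]; the exponent [n] is the sum of the [n_j], so that [X^n]
    is a multiple of every [x_j^(n_j)]. *)
Lemma monic_reversible_after_shift u :
  artinian R -> monic_ideal (annihilator u) ->
  exists n, reversible_ideal (annihilator (('X_[mones k] : {mpoly R[k]}) ^+ n *: u)).
Proof.
move=> Rart umon.
have /choice [nr nrP] : forall j : 'I_k, exists nr : nat * {poly R},
    reversible_poly nr.2 /\ ('X_j ^+ nr.1 * poly_at j nr.2) *: u = 0.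
  move=> j; have [q qmon qu] := umon j.
  have [n [r [s [rrev e]]]] := monic_dvd_Xn_reversible Rart qmon.
  exists (n, r); split=> //=.
  rewrite -poly_atXn -poly_at_prod -e poly_at_prod -scalerA.
  by rewrite [_ *: u]qu scaler0.
exists (\sum_j (nr j).1)%N => j; have [rrev ru] := nrP j.
exists (nr j).2 => //.
rewrite mpolyX_mones (bigD1 j) //= exprMn [X in _ ^+ X * _](bigD1 j) //= exprD.
rewrite -mulrA mulrC -scalerA; apply: annihilatorZ.
by rewrite /annihilator /= scalerA mulrC.
Qed.

(** If [r(x_j) u = 0] and [c r(0) = 1], then [u = x_j g u] where
    [1 - x_j g = c r(x_j)]. *)
Lemma reversible_invertible u : reversible_ideal (annihilator u) ->
  exists G : {mpoly R[k]}, ('X_[mones k] * G) *: u = u.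
Proof.
move=> urev.
have /choice [g gP] : forall j : 'I_k, exists g : {mpoly R[k]},
    ('X_j * g) *: u = u.
  move=> j; have [r [_ [c c1]] ru] := urev j.
  elim/poly_ind: r c1 ru => [|p a _]; rewrite !hornerE.
    by move=> /esym/eqP; rewrite oner_eq0.
  move=> ca /(congr1 (fun v => c%:MP *: v)).
  rewrite scaler0 scalerA poly_atD poly_at_prod poly_atC mulrDr -mpolyCM ca.
  rewrite scalerDl scale1r => /eqP; rewrite addr_eq0 => /eqP e.
  exists (- (c%:MP * poly_at j p)); rewrite mulrN scaleNr.
  have -> : 'X_j * (c%:MP * poly_at j p) = c%:MP * (poly_at j p * poly_at j 'X).
    by rewrite -['X]expr1 poly_atXn expr1 mulrCA [_ * 'X_j]mulrC.
  by rewrite e opprK.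
exists (\prod_j g j); rewrite mpolyX_mones -big_split /=.
elim/big_rec: _ => [|j f _ IHf]; first by rewrite scale1r.
by rewrite -scalerA IHf gP.
Qed.

Lemma scale_pow_fixed (f g : {mpoly R[k]}) u n :
  (f * g) *: u = u -> (f ^+ n * g ^+ n) *: u = u.
Proof.
move=> fgu; elim: n => [|n IHn]; first by rewrite !expr0 mulr1 scale1r.
by rewrite !exprS mulrACA -scalerA IHn.
Qed.

End PolyAt.

(** * Restriction and extension *)

Section Restriction.
Variables (R : comNzRingType) (M : lmodType R) (k : nat).
Implicit Types (u : kseq M k) (w : kbiseq M k).

Lemma kseq_scaleX (m n : 'X_{1..k}) u :
  (('X_[m] : {mpoly R[k]}) *: u) n = u (n + m)%MM.
Proof. by rewrite kseq_scaleE msuppX big_seq1 mcoeffX eqxx scale1r. Qed.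

Lemma kbiseq_scaleX (m : 'X_{1..k}) n w :
  (('X_[m] : {mpoly R[k]}) *: w) n = w (n + mnm_int m).
Proof. by rewrite kbiseq_scaleE msuppX big_seq1 mcoeffX eqxx scale1r. Qed.

Lemma kbiseq_scaleX_inj (m : 'X_{1..k}) w :
  ('X_[m] : {mpoly R[k]}) *: w = 0 -> w = 0.
Proof.
move=> w0; apply/funext => n.
by have := congr1 (@^~ (n - mnm_int m)) w0; rewrite /= kbiseq_scaleX subrK.
Qed.

Lemma kbiseq_scaleX_surj (m : 'X_{1..k}) w :
  exists w', ('X_[m] : {mpoly R[k]}) *: w' = w.
Proof.
exists (fun n => w (n - mnm_int m)); apply/funext => n.
by rewrite kbiseq_scaleX addrK.
Qed.

Lemma kbiseq_annihilatorX (m : 'X_{1..k}) w :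
  annihilator (('X_[m] : {mpoly R[k]}) *: w) = annihilator w.
Proof.
apply/seteqP; split=> f; last exact: annihilatorZ.
rewrite /annihilator /= scalerA mulrC -scalerA.
exact: kbiseq_scaleX_inj.
Qed.

Lemma mnm_intD (m n : 'X_{1..k}) : mnm_int (m + n)%MM = mnm_int m + mnm_int n.
Proof. by apply/ffunP => j; rewrite !ffunE mnmDE PoszD. Qed.

Lemma mnm_int_inj : injective (@mnm_int k).
Proof.
by move=> m n /ffunP e; apply/mnmP => j; have := e j; rewrite !ffunE => -[].
Qed.

Definition index_bound (n : {ffun 'I_k -> int}) : nat := (\sum_j `|n j|)%N.

(** The translate of [n] by [(N, ..., N)] with [N = index_bound n].  Its
    entries are nonnegative, so that the absolute value only changes the type
    from [int] to [nat]. *)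
Definition nonneg_translate (n : {ffun 'I_k -> int}) : 'X_{1..k} :=
  [multinom `|(n j + (index_bound n)%:Z)%R|%N | j < k].

Lemma nonneg_translateE n :
  mnm_int (nonneg_translate n) = n + mnm_int (mones k *+ index_bound n)%MM.
Proof.
apply/ffunP => j; rewrite !ffunE mulmnE !mnmE mul1n abszE ger0_norm //.
rewrite -lerBlDl sub0r (le_trans (ler_norm _)) // normrN -abszE lez_nat.
by rewrite /index_bound (bigD1 j) //= leq_addr.
Qed.

Definition restrict w : kseq M k := fun n => w (mnm_int n).

Lemma restrict_is_linear : linear restrict.
Proof.
move=> f w w'; apply/funext => n.
transitivity ((f *: restrict w) n + restrict w' n); last by [].
rewrite kseq_scaleE; congr (_ + _).
by apply: eq_bigr => i _; rewrite /restrict mnm_intD.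
Qed.

HB.instance Definition _ := GRing.isLinear.Build {mpoly R[k]}
  (kbiseq M k) (kseq M k) *:%R restrict restrict_is_linear.

Lemma annihilator_restrict w f :
  annihilator w f -> annihilator (restrict w) f.
Proof. by rewrite /annihilator /= -linearZ /= => ->; rewrite linear0. Qed.

Lemma lin_birec_restrict w : bi_lin_birec M k w -> lin_birec M k (restrict w).
Proof.
move=> wrev j; have [q qrev qw] := wrev j.
by exists q => //; exact: annihilator_restrict.
Qed.

Lemma lin_birec_lin_rec u : lin_birec M k u -> lin_rec M k u.
Proof. by move=> urev j; have [q [qmon _] qu] := urev j; exists q. Qed.

(** As [w = X^N G^N w], the value [w(n)] is a value of [G^N w] at the index
    [n + (N, ..., N)], which is nonnegative for large [N]. *)
Lemma restrict_inj w : bi_lin_birec M k w -> restrict w = 0 -> w = 0.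
Proof.
move=> /reversible_invertible [G Gw] w0.
apply/funext => n; pose N := index_bound n.
rewrite -(scale_pow_fixed N Gw) -scalerA mpolyXn kbiseq_scaleX.
rewrite -nonneg_translateE.
transitivity (restrict (G ^+ N *: w) (nonneg_translate n)); first by [].
by rewrite linearZ /= w0 scaler0.
Qed.

(** The values [(G^N u)(n + (N, ..., N))] stabilise at once: replacing [N] by
    [N + 1] inserts the operator [X G], which fixes [u]. *)
Lemma reversible_has_reverse u : lin_birec M k u ->
  exists w, restrict w = u /\ annihilator w = annihilator u.
Proof.
move=> /reversible_invertible [G Gu].
have shiftN N p m :
    (G ^+ (N + p) *: u) (m + mones k *+ p)%MM = (G ^+ N *: u) m.
  rewrite -kseq_scaleX -mpolyXn scalerA exprD mulrCA -scalerA.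
  by rewrite scale_pow_fixed.
pose w : kbiseq M k := fun n =>
  (G ^+ index_bound n *: u) (nonneg_translate n).
have mindep n N1 N2 m1 m2 : mnm_int m1 = n + mnm_int (mones k *+ N1)%MM ->
    mnm_int m2 = n + mnm_int (mones k *+ N2)%MM ->
    (N1 <= N2)%N -> (G ^+ N1 *: u) m1 = (G ^+ N2 *: u) m2.
  move=> e1 e2 leN; rewrite -(shiftN N1 (N2 - N1)%N m1) subnKC //.
  apply: congr1; apply: mnm_int_inj; rewrite e2 mnm_intD e1 -addrA.
  rewrite -mnm_intD; congr (_ + mnm_int _); apply/mnmP => j.
  by rewrite mnmDE !mulmnE -mulnDr subnKC.
have wE n N0 m : mnm_int m = n + mnm_int (mones k *+ N0)%MM ->
    w n = (G ^+ N0 *: u) m.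
  move=> em; have ew := nonneg_translateE n.
  case: (leqP (index_bound n) N0) => [le|/ltnW le]; first exact: mindep ew em le.
  by apply/esym; exact: mindep em ew le.
have wu : restrict w = u.
  apply/funext => n; rewrite /restrict (wE _ 0%N n) ?expr0 ?scale1r //.
  by apply/ffunP => j; rewrite !ffunE mulmnE muln0 addr0.
exists w; split=> //; apply/seteqP; split=> f.
  by move/annihilator_restrict; rewrite wu.
rewrite /annihilator /= => fu; apply/funext => n; rewrite kbiseq_scaleE.
transitivity ((f *: (G ^+ index_bound n *: u)) (nonneg_translate n)).
  rewrite kseq_scaleE; apply: eq_bigr => i _; congr (_ *: _).
  by apply: wE; rewrite mnm_intD nonneg_translateE addrAC.
by rewrite scalerA mulrC -scalerA fu scaler0.
Qed.

Lemma bi_lin_rec_birec : artinian R -> bi_lin_rec M k = bi_lin_birec M k.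
Proof.
move=> Rart; apply/seteqP; split=> w wP.
  have [n] := monic_reversible_after_shift Rart wP.
  by rewrite mpolyXn kbiseq_annihilatorX.
by move=> j; have [q [qmon _] qw] := wP j; exists q.
Qed.

Lemma lin_birec_reversible : artinian R -> lin_birec M k = reversible_seq M k.
Proof.
move=> Rart; apply/seteqP; split=> u.
  move=> urev; have [w [wu annw]] := reversible_has_reverse urev; split.
    exact: lin_birec_lin_rec.
  exists w; last by split=> // n; rewrite -wu.
  by rewrite bi_lin_rec_birec // /bi_lin_birec /= annw.
move=> [_ [w]]; rewrite bi_lin_rec_birec // => wP [_ annw].
by move: wP; rewrite /bi_lin_birec /= annw.
Qed.

Definition add_restrict (p : kseq M k * kbiseq M k) : kseq M k :=
  p.1 + restrict p.2.

Lemma add_restrict_is_linear : linear add_restrict.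
Proof.
by move=> f p q; rewrite /add_restrict /= linearP scalerDr addrACA.
Qed.

HB.instance Definition _ := GRing.isLinear.Build {mpoly R[k]}
  (kseq M k * kbiseq M k)%type (kseq M k) *:%R add_restrict
  add_restrict_is_linear.

End Restriction.

(** * Isomorphisms of submodules *)

Lemma submod_closed_linear (S : nzRingType) (U : lmodType S) (A : set U) a u v :
  submod_closed (mem A) -> A u -> A v -> A (a *: u + v).
Proof.
by move=> [_ AD] Au Av; apply: set_mem; apply: AD; exact: mem_set.
Qed.

Section SubmodIso.
Variables (S : nzRingType) (U V : lmodType S) (A : set U) (B : set V).

Lemma linear_set_inj (f : {linear U -> V}) : submod_closed (mem A) ->
  (forall u, A u -> f u = 0 -> u = 0) -> set_inj A f.
Proof.
move=> Asub f0 u v /set_mem Au /set_mem Av e.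
apply/eqP; rewrite -subr_eq0; apply/eqP/f0; last by rewrite linearB /= e subrr.
by rewrite addrC -scaleN1r; exact: submod_closed_linear.
Qed.

Lemma submod_iso_inverse (f : {linear V -> U}) :
  submod_closed (mem B) -> set_bij B A f -> submod_iso A B.
Proof.
move=> Bsub [fBA finj fsurj].
have /choice [g gP] : forall u, exists v, A u -> B v /\ f v = u.
  move=> u; case: (pselect (A u)) => [/fsurj [v Bv fv]|nAu]; first by exists v.
  by exists 0.
have gE v u : B v -> f v = u -> g u = v.
  move=> Bv fv; have Au : A u by rewrite -fv; exact: fBA.
  have [Bg fg] := gP u Au.
  by apply: finj; [exact: mem_set | exact: mem_set | rewrite fg fv].
exists g; split; first split.
- by move=> u /gP [].
- move=> u v /set_mem /gP [_ fu] /set_mem /gP [_ fv] e.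
  by rewrite -fu -fv e.
- move=> v Bv; exists (f v); [exact: fBA | exact: gE].
- move=> u v /set_mem /gP [Bu fu] /set_mem /gP [Bv fv]; apply: gE.
    by rewrite -[g u]scale1r; exact: submod_closed_linear.
  by rewrite linearD /= fu fv.
move=> a u /set_mem /gP [Bu fu]; apply: gE; last by rewrite linearZ /= fu.
by rewrite -[a *: _]addr0; apply: submod_closed_linear => //; exact: set_mem Bsub.1.
Qed.

Lemma submod_closed_prod :
  submod_closed (mem A) -> submod_closed (mem B) ->
  submod_closed (mem (A `*` B)).
Proof.
move=> Asub Bsub; split.
  by apply/mem_set; split; apply: set_mem; [exact: Asub.1 | exact: Bsub.1].
move=> a u v /set_mem [Au Bu] /set_mem [Av Bv]; apply/mem_set.
by split; exact: submod_closed_linear.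
Qed.

End SubmodIso.

Section Decomposition.
Variables (R : comNzRingType) (M : lmodType R) (k : nat).

(** A monomial which kills [d = - restrict w] kills [w]. *)
Lemma add_restrict_inj :
  set_inj (degenerating M k `*` bi_lin_birec M k) (@add_restrict R M k).
Proof.
apply: linear_set_inj.
  apply: submod_closed_prod; first exact: degenerating_submod.
  exact: bi_lin_birec_submod.
move=> [d w] [/= [_ [m md]] wrev]; rewrite /add_restrict /= => dw0.
have w0 : w = 0.
  apply: (@kbiseq_scaleX_inj _ _ _ m); apply: restrict_inj.
    by rewrite /bi_lin_birec /= kbiseq_annihilatorX.
  have := congr1 (fun v => ('X_[m] : {mpoly R[k]}) *: v) dw0.
  by rewrite scalerDr md add0r scaler0 -linearZ.
by move: dw0; rewrite w0 linear0 addr0 => ->.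
Qed.

Lemma add_restrict_surj : artinian R ->
  set_surj (degenerating M k `*` bi_lin_birec M k) (lin_rec M k)
    (@add_restrict R M k).
Proof.
move=> Rart u urec.
have [n urev] := monic_reversible_after_shift Rart urec.
have [w' [w'u annw']] := reversible_has_reverse urev.
have [w ww'] := kbiseq_scaleX_surj (mones k *+ n)%MM w'.
have wrev : bi_lin_birec M k w.
  rewrite /bi_lin_birec /= -(kbiseq_annihilatorX (mones k *+ n)%MM w) ww'.
  by rewrite annw'.
exists (u - restrict w, w); last by rewrite /add_restrict /= subrK.
split=> //; split => /=; last first.
  exists (mones k *+ n)%MM; rewrite scalerBr -linearZ /= ww' w'u -mpolyXn.
  by rewrite subrr.
rewrite addrC -scaleN1r.
apply: (submod_closed_linear _ (lin_rec_submod k M)) => //.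
exact/lin_birec_lin_rec/lin_birec_restrict.
Qed.

End Decomposition.

Theorem proposition3p13 (R : comNzRingType) (k : nat) (k_ge1 : (1 <= k)%N)
    (M : lmodType R) (R_artinian : artinian R) :
  [/\ submod_iso (lin_rec M k) (degenerating M k `*` bi_lin_rec M k),
      degenerating M k `*` bi_lin_rec M k =
        degenerating M k `*` bi_lin_birec M k,
      submod_iso (degenerating M k `*` bi_lin_birec M k)
        (degenerating M k `*` lin_birec M k) &
      degenerating M k `*` lin_birec M k =
        degenerating M k `*` reversible_seq M k].
Proof.
have birec : bi_lin_rec M k = bi_lin_birec M k by exact: bi_lin_rec_birec.
split.
- rewrite birec; apply: (@submod_iso_inverse _ _ _ _ _ (@add_restrict R M k)).
    by apply: submod_closed_prod;
      [exact: degenerating_submod | exact: bi_lin_birec_submod].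
  split; last exact: add_restrict_surj.
    move=> [d w] [/= [dL _] wrev]; rewrite /add_restrict /= -[d]scale1r.
    apply: (submod_closed_linear _ (lin_rec_submod k M)) => //.
    exact/lin_birec_lin_rec/lin_birec_restrict.
  exact: add_restrict_inj.
- by rewrite birec.
- exists (fun p => (p.1, restrict p.2)); split; first split.
  + move=> [d w] [/= dD wrev]; split=> //=.
    exact: lin_birec_restrict.
  + move=> [d w] [d' w'] /set_mem [_ /= wP] /set_mem [_ /= wP'] [-> e].
    have rinj := linear_set_inj (bi_lin_birec_submod k M) (@restrict_inj R M k).
    by congr (_, _); apply: rinj e; exact: mem_set.
  + move=> [d u] [/= dD urev].
    have [w [wu annw]] := reversible_has_reverse urev.
    by exists (d, w); rewrite /= ?wu //; split; rewrite //= /bi_lin_birec /= annw.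
  + by move=> [d w] [d' w'] _ _; rewrite /= linearD.
  + by move=> a [d w] _; rewrite /= linearZ.
- by rewrite lin_birec_reversible.
Qed.
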